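(* Let $R$ be a p.q.-Baer $*$-ring and let $a$ be a cut vertex of $\Gamma^*_s(R)$. Then $a$ is a central projection of $R$ and $a$ is an atom in the lattice $L(CP(R))$ of central projections of $R$.
   Context: A $*$-ring is a ring $R$ with an involution $x\mapsto x^*$. A projection is an element $e$ with $e^2=e=e^*$; a central projection is a projection in the centre of $R$, and $CP(R)$ is the set of them. $CP(R)$ is a lattice under $e\leq f$ iff $e=ef=fe$, with $e\wedge f=ef$, $e\vee f=e+f-ef$; an atom is a nonzero $e$ such that $0\leq f\leq e$ implies $f=0$ or $f=e$. For $S\subseteq R$, $r_R(S)=\{x\in R: sx=0\ \forall s\in S\}$. $R$ is a p.q.-Baer $*$-ring if for every $a\in R$, $r_R(aR)=eR$ for some projection $e\in R$. The strong zero-divisor graph $\Gamma^*_s(R)$ is the simple undirected graph with vertex set $\{0\neq a\in R: r_R(aR)\neq\{0\}\}$, distinct vertices $a,b$ adjacent iff $aRb^*=0$. A cut vertex is a vertex whose removal increases the number of connected components. *)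

(* Defs.v *)
From HB Require Import structures.
From Stdlib Require Import Relation_Operators.
From mathcomp Require Import all_boot ssralg.
From mathcomp Require Import boolp classical_sets functions cardinality.

Set Implicit Arguments.
Unset Strict Implicit.
Unset Printing Implicit Defensive.

Import GRing.Theory.
Local Open Scope ring_scope.
Local Open Scope classical_set_scope.
Local Open Scope card_scope.

(* Requiring a unit loses no p.q.-Baer *-ring: r(0R) = R = eR with e a
   projection forces e to be a two-sided unit. *)
HB.mixin Record isStarRing R of GRing.PzRing R := {
  star : R -> R;
  starK : involutive star;
  starD : {morph star : x y / x + y};
  starM : forall x y, star (x * y) = star y * star x
}.

#[short(type="starRingType")]
HB.structure Definition StarRing := {R of isStarRing R & GRing.PzRing R}.

Section StarRings.
Variable R : starRingType.
Implicit Types (a b e f x : R) (S : set R).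

Lemma star0 : star 0 = 0 :> R.
Proof. by apply: (addrI (star 0)); rewrite -starD !addr0. Qed.

Definition projection e : Prop := e * e = e /\ star e = e.

Definition central_projection e : Prop :=
  projection e /\ forall x, e * x = x * e.

Definition CP : set R := [set e | central_projection e].

Definition cp_le e f : Prop := e = e * f /\ e = f * e.

Definition cp_atom e : Prop :=
  [/\ CP e, e <> 0 &
      forall f, CP f -> cp_le 0 f -> cp_le f e -> f = 0 \/ f = e].

Definition rann S : set R := [set x | forall s, S s -> s * x = 0].

Definition rmulset a : set R := [set a * x | x in [set: R]].

Definition pq_Baer : Prop :=
  forall a, exists2 e, projection e & rann (rmulset a) = rmulset e.

End StarRings.

Record sgraph (T : Type) := SGraph {
  vertex : set T;
  edge : T -> T -> Prop;
  edge_vertex : forall x y, edge x y -> vertex x /\ vertex y;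
  edge_sym : forall x y, edge x y -> edge y x;
  edge_irr : forall x, ~ edge x x
}.

Section Graphs.
Variable T : Type.
Implicit Types (G : sgraph T) (v : T).

Definition del_edge G v (x y : T) : Prop := [/\ edge G x y, x <> v & y <> v].

Lemma del_edge_vertex G v x y :
  del_edge G v x y -> (vertex G `\ v) x /\ (vertex G `\ v) y.
Proof. by move=> [Gxy xv yv]; have [Vx Vy] := edge_vertex Gxy; split; split. Qed.

Lemma del_edge_sym G v x y : del_edge G v x y -> del_edge G v y x.
Proof. move=> [Gxy xv yv]; split=> //; exact: edge_sym. Qed.

Lemma del_edge_irr G v x : ~ del_edge G v x x.
Proof. by move=> [Gxx _ _]; apply: edge_irr Gxx. Qed.

Definition del_vertex G v : sgraph T :=
  SGraph (@del_edge_vertex G v) (@del_edge_sym G v) (@del_edge_irr G v).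

Definition component G (x : T) : set T :=
  [set y | clos_refl_trans T (edge G) x y].

Definition components G : set (set T) :=
  [set component G x | x in vertex G].

(* The set of components may be infinite, so "increases the number of
   components" is strict inequality of cardinals. *)
Definition cut_vertex G v : Prop :=
  [/\ vertex G v,
      components G #<= components (del_vertex G v) &
      ~ (components (del_vertex G v) #<= components G)].

End Graphs.

Section StrongZeroDivisorGraph.
Variable R : starRingType.

Definition szd_vertex : set R :=
  [set a | a <> 0 /\ rann (rmulset a) <> [set 0]].

Definition szd_edge (a b : R) : Prop :=
  [/\ szd_vertex a, szd_vertex b, a <> b & forall x, a * x * star b = 0].

Lemma szd_edge_vertex (a b : R) :
  szd_edge a b -> szd_vertex a /\ szd_vertex b.
Proof. by case. Qed.

Lemma szd_edge_sym (a b : R) : szd_edge a b -> szd_edge b a.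
Proof.
case=> Va Vb ab0 H; split=> // [ba|x]; first exact: ab0.
apply: (can_inj starK); rewrite star0 !starM starK mulrA; exact: H.
Qed.

Lemma szd_edge_irr (a : R) : ~ szd_edge a a.
Proof. by case. Qed.

Definition strong_zero_divisor_graph : sgraph R :=
  SGraph szd_edge_vertex szd_edge_sym szd_edge_irr.

End StrongZeroDivisorGraph.

(* Main.v *)
Require Import Defs.
From HB Require Import structures.
From mathcomp Require Import all_boot ssralg.
From mathcomp Require Import boolp classical_sets functions cardinality.
From Stdlib Require Import Relation_Operators.

(** In a p.q.-Baer *-ring the right annihilator of [xR] is generated by a
    central projection [e], and [x] is adjacent to every nonzero central
    projection below [e].  Let [x], [y] be separated by deleting [a], with
    annihilator projections [e], [f].  If [e * f] is nonzero, every nonzero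
    central projection [g] below it gives a path [x - g - y], so [g = a].
    If [e * f = 0], all nonzero central projections [g] below [e] and [h]
    below [f] give a path [x - g - h - y], so [g = a] or [h = a]; this forces
    [e] or [f] to equal [a] and to have no other nonzero central projection
    below it. *)

Set Implicit Arguments.
Unset Strict Implicit.
Unset Printing Implicit Defensive.

Import GRing.Theory.
Local Open Scope ring_scope.
Local Open Scope classical_set_scope.
Local Open Scope card_scope.

(** If no two remaining vertices were separated, the graph without [v] would have at most one
    component, while [G] has at least that of [v], so their number could not increase. *)
Lemma cut_vertex_separates (T : Type) (G : sgraph T) (v : T) :
  cut_vertex G v ->
  exists x y, [/\ vertex G x, vertex G y, x <> v, y <> v &
    ~ clos_refl_trans T (edge (del_vertex G v)) x y].
Proof.
move=> [Gv _ nle]; apply: contrapT => nsep; apply: nle.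
have conn x y : vertex (del_vertex G v) x -> vertex (del_vertex G v) y ->
    clos_refl_trans T (edge (del_vertex G v)) x y.
  move=> [Gx xv] [Gy yv]; apply: contrapT => nxy.
  by apply: nsep; exists x, y; split.
have [->|/set0P[_ [x0 Gx0 _]]] := eqVneq (components (del_vertex G v)) set0.
  exact: card_ge0.
have sub1 :
    components (del_vertex G v) `<=` [set component (del_vertex G v) x0].
  move=> _ [x Gx <-]; apply/seteqP; split=> y; apply: rt_trans; exact: conn.
apply: card_le_trans (subset_card_le sub1) _.
have /card_eqPle[le1 _] := card_set1 (x := component (del_vertex G v) x0).
have /card_eqPle[_ ge1] := card_set1 (x := component G v).
apply: card_le_trans le1 (card_le_trans ge1 _).
by apply: subset_card_le => _ ->; exists v.
Qed.

Section PqBaerStarRing.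
Variable R : starRingType.
Hypothesis hR : pq_Baer R.
Implicit Types (a b e f g h x y : R).

(** As [e] is idempotent, [e * b = b] expresses that [b] lies in [eR]. *)
Definition is_ann_proj x e : Prop :=
  central_projection e /\ forall b, (forall r, x * r * b = 0) <-> e * b = b.

Lemma ann_proj_exists x : exists e, is_ann_proj x e.
Proof.
have [e [ee se] annE] := hR x.
have annP b : (forall r, x * r * b = 0) <-> e * b = b.
  have annb : rann (rmulset x) b <-> (forall r, x * r * b = 0).
    by split=> [xb r|xb _ [r _ <-]]; [apply: xb; exists r | exact: xb].
  rewrite -annb annE; split=> [[c _ <-]|<-]; first by rewrite mulrA ee.
  by exists b.
(* [eR] is a left ideal, i.e. [re = ere]; applying [star] gives [er = ere]. *)
have ideal r : e * r * e = r * e.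
  rewrite -mulrA; apply/annP => s.
  by rewrite mulrA -(mulrA x); apply: (annP e).2.
exists e; split=> //; split=> // r.
have /(congr1 (@star R)) := ideal (star r).
by rewrite !starM se starK mulrA ideal => ->.
Qed.

Lemma mul_ann_proj x e : is_ann_proj x e -> x * e = 0.
Proof. by move=> [[[ee _] _] /(_ e)[_ /(_ ee 1)]]; rewrite mulr1. Qed.

Lemma star_neq0 x : x <> 0 -> star x <> 0.
Proof. by move=> x0 sx; apply: x0; rewrite -[x]starK sx star0. Qed.

(** The vertex conditions come for free: [star y] is a nonzero element annihilated by [xR], and
    symmetrically for [star x]. If [x = y], then [star x] lies in [eR] for the annihilator
    projection [e] of [x]; applying [star] gives [x = x * e = 0]. *)
Lemma szd_edgeI x y :
  x <> 0 -> y <> 0 -> (forall r, x * r * star y = 0) -> szd_edge x y.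
Proof.
have vI (u w : R) : u <> 0 -> w <> 0 -> (forall r, u * r * star w = 0) ->
    szd_vertex u.
  move=> u0 w0 uw; split=> // ann0; apply: (star_neq0 w0).
  suff : rann (rmulset u) (star w) by rewrite ann0.
  by move=> _ [r _ <-].
move=> x0 y0 xy; split; [exact: vI xy| |move=> exy; apply: x0|exact: xy].
  apply: (vI y x) => // r; apply: (can_inj starK).
  by rewrite star0 !starM starK mulrA.
have [e annx] := ann_proj_exists x.
have [[[_ se] _] annP] := annx.
have : e * star x = star x by apply/annP; rewrite {2}exy.
by move=> /(congr1 (@star R)); rewrite starM starK se (mul_ann_proj annx).
Qed.

Lemma szd_edge_ann_proj x e g : x <> 0 -> is_ann_proj x e ->
  CP g -> g <> 0 -> g * e = g -> szd_edge x g.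
Proof.
move=> x0 [[_ ce] annP] [[_ sg] _] g0 ge.
by apply: szd_edgeI => //; rewrite sg; apply/annP; rewrite ce.
Qed.

Lemma szd_edge_CP g h :
  CP g -> CP h -> g <> 0 -> h <> 0 -> g * h = 0 -> szd_edge g h.
Proof.
move=> [_ cg] [[_ sh] _] g0 h0 gh; apply: szd_edgeI => // r.
by rewrite sh cg -mulrA gh mulr0.
Qed.

Lemma ann_proj_neq0 x e : szd_vertex x -> is_ann_proj x e -> e <> 0.
Proof.
move=> [_ nz] [_ annP] e0; apply: nz; apply/seteqP; split=> [b xb|b ->].
  have /annP <- : forall r, x * r * b = 0 by move=> r; apply: xb; exists r.
  by rewrite e0 mul0r.
by move=> s _; rewrite mulr0.
Qed.

Lemma CP_mul e f : CP e -> CP f -> CP (e * f).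
Proof.
move=> [[ee se] ce] [[ff sf] cf]; split; first split.
- by rewrite -mulrA (mulrA f) cf -mulrA ff mulrA ee.
- by rewrite starM se sf ce.
- by move=> x; rewrite -mulrA cf mulrA ce mulrA.
Qed.

(** The hypothesis applied to [e] itself gives [e = a], so any nonzero central projection below [e]
    is [e]. *)
Lemma cp_atomI a e : CP e -> e <> 0 ->
  (forall g, CP g -> g <> 0 -> g * e = g -> g = a) ->
  central_projection a /\ cp_atom a.
Proof.
move=> CPe e0 onlya.
have -> : a = e by rewrite (onlya e) //; case: CPe => -[].
split=> //; split=> // g CPg _ [ge _].
have [->|/eqP g0] := eqVneq g 0; [by left | right].
by rewrite (onlya g) // (onlya e) //; case: CPe => -[].
Qed.

End PqBaerStarRing.

Theorem theorem3p4 (R : starRingType) (hR : pq_Baer R) (a : R)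
    (ha : cut_vertex (strong_zero_divisor_graph R) a) :
  central_projection a /\ cp_atom a.
Proof.
have [x [y [Vx Vy xa ya nxy]]] := cut_vertex_separates ha.
have [[x0 _] [y0 _]] := (Vx, Vy).
have [e annx] := ann_proj_exists hR x.
have [f anny] := ann_proj_exists hR y.
have e0 := ann_proj_neq0 Vx annx; have f0 := ann_proj_neq0 Vy anny.
have [CPe _] := annx; have [CPf _] := anny.
have [[ee _] ce] := CPe; have [[ff _] cf] := CPf.
have [ef0|/eqP ef0] := eqVneq (e * f) 0; last first.
  apply: (cp_atomI (CP_mul CPe CPf)) => // g CPg g0 gef.
  have gf : g * f = g by rewrite -gef -!mulrA ff.
  have ge : g * e = g by rewrite -gef ce -!mulrA ee.
  apply: contrapT => ga; apply: nxy; apply: (@rt_trans _ _ _ g); apply: rt_step.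
    by split=> //; apply: szd_edge_ann_proj annx _ _ _.
  by apply: edge_sym; split=> //; apply: szd_edge_ann_proj anny _ _ _.
have dich g h : CP g -> g <> 0 -> g * e = g ->
    CP h -> h <> 0 -> h * f = h -> g = a \/ h = a.
  move=> CPg g0 ge CPh h0 hf.
  have [->|/eqP ga] := eqVneq g a; [by left | right].
  apply: contrapT => ha'; apply: nxy.
  (* Centrality of [f] turns [g * e * (h * f)] into [g * (e * f) * h]. *)
  have gh : g * h = 0 by rewrite -ge -hf -cf -mulrA (mulrA e) ef0 mul0r mulr0.
  apply: (@rt_trans _ _ _ g).
    by apply: rt_step; split=> //; apply: szd_edge_ann_proj annx _ _ _.
  apply: (@rt_trans _ _ _ h).
    by apply: rt_step; split=> //; apply: szd_edge_CP.
  apply: rt_step; apply: edge_sym.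
  by split=> //; apply: szd_edge_ann_proj anny _ _ _.
have ef : e <> f by move=> eqef; apply: e0; rewrite -ef0 -eqef.
(* Whichever of [e] and [f] equals [a], the other does not; [dich] against that other one then
   forces every nonzero central projection below the first to be [a]. *)
have [ea|fa] := dich e f CPe e0 ee CPf f0 ff.
  apply: (cp_atomI CPe e0) => g CPg g0 ge.
  have [//|fa] := dich g f CPg g0 ge CPf f0 ff.
  by case: ef; rewrite ea fa.
apply: (cp_atomI CPf f0) => h CPh h0 hf.
have [ea|//] := dich e h CPe e0 ee CPh h0 hf.
by case: ef; rewrite ea fa.
Qed.
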